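(* Let $v_1,\ldots,v_m$ be points in $\mathbb{N}^s$, let $\mathcal{P}=\mathrm{conv}(v_1,\ldots,v_m)$, and let $w:\mathbb{R}^s\to\mathbb{R}$ be a non-zero linear function such that $w(e_i)\in\mathbb{N}$ for $i=1,\ldots,s$. The following hold. (a) $E_{\mathcal{P}}^{s,w}(n):=\sum_{a\in n\mathcal{P}\cap\mathbb{Z}^s}w(a)=E_{\mathcal{P}_w}(n)-E_{\mathcal{P}}(n)$ for $n\ge0$, where $\mathcal{P}_w=\mathrm{conv}((v_1,0),\ldots,(v_m,0),(v_1,w(v_1)),\ldots,(v_m,w(v_m)))$. (b) If $w=\sum_{i=1}^s\eta_it_i$, $t_i\not\equiv0$ on $\mathcal{P}$ whenever $\eta_i>0$, and $d=\dim(\mathcal{P})$, then $E_{\mathcal{P}}^{s,w}$ is a polynomial of degree $d+1$ and its generating function is $$F_{\mathcal{P}}^{s,w}(x):=\sum_{n=0}^\infty E_{\mathcal{P}}^{s,w}(n)x^n=\frac{h(x)}{(1-x)^{d+2}},$$ where $h(x)$ is a polynomial of degree at most $d+1$ with nonnegative integer coefficients.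
   Context: $\mathbb{N}=\{0,1,2,\ldots\}$; $e_i$ is the $i$-th unit vector of $\mathbb{R}^s$ and $t_i$ is viewed as the $i$-th coordinate function on $\mathbb{R}^s$. For a lattice polytope $\mathcal{Q}\subset\mathbb{R}^N$, $E_{\mathcal{Q}}(n)=|n\mathcal{Q}\cap\mathbb{Z}^N|$ is its Ehrhart function. The superscript $s$ in $E_{\mathcal{P}}^{s,w}$ names the weighting. *)

(* Defs.v *)
From HB Require Import structures.
From mathcomp Require Import all_boot all_order all_algebra finmap.
From mathcomp Require Import mathcomp_extra boolp classical_sets functions.
From mathcomp Require Import cardinality fsbigop reals.

Set Implicit Arguments.
Unset Strict Implicit.
Unset Printing Implicit Defensive.

Import Order.TTheory GRing.Theory Num.Theory.

Local Open Scope classical_set_scope.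
Local Open Scope ring_scope.

Section Polytopes.
Variable R : realType.

Definition conv_hull N (A : set 'rV[R]_N) : set 'rV[R]_N :=
  [set x | exists (k : nat) (p : 'I_k -> 'rV[R]_N) (c : 'I_k -> R),
     [/\ forall i, A (p i), forall i, 0 <= c i, \sum_(i < k) c i = 1
       & x = \sum_(i < k) c i *: p i]].

Definition affine_hull N (A : set 'rV[R]_N) : set 'rV[R]_N :=
  [set x | exists (k : nat) (p : 'I_k -> 'rV[R]_N) (c : 'I_k -> R),
     [/\ forall i, A (p i), \sum_(i < k) c i = 1
       & x = \sum_(i < k) c i *: p i]].

(* The affine hull of A is a translate x0 + U of a linear subspace U of
   dimension d; this determines d. No d satisfies it when A is empty. *)
Definition has_dim N (A : set 'rV[R]_N) (d : nat) : Prop :=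
  exists (x0 : 'rV[R]_N) (U : {vspace 'rV[R]_N}),
    affine_hull A = [set x | x - x0 \in U] /\ \dim U = d.

Definition dilate N (n : nat) (A : set 'rV[R]_N) : set 'rV[R]_N :=
  [set n%:R *: x | x in A].

Definition lattice_points N (A : set 'rV[R]_N) : set 'rV[R]_N :=
  [set x | A x /\ forall i, x 0 i \is a Num.int].

(* fset_set and the finitely supported sum \sum_(_ \in _) have their intended
   meaning on finite sets; dilates of a polytope have finitely many lattice
   points. *)
Definition ehrhart N (Q : set 'rV[R]_N) (n : nat) : nat :=
  #|` fset_set (lattice_points (dilate n Q)) |.

Definition weighted_ehrhart N (Q : set 'rV[R]_N) (w : 'rV[R]_N -> R)
    (n : nat) : R :=
  \sum_(a \in lattice_points (dilate n Q)) w a.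

(* conv ((v_1, 0), ..., (v_m, 0), (v_1, w v_1), ..., (v_m, w v_m)) *)
Definition lifted_polytope s m (v : 'I_m -> 'rV[R]_s) (w : 'rV[R]_s -> R) :
    set 'rV[R]_(s + 1) :=
  conv_hull ([set row_mx (v j) (0 : 'rV[R]_1) | j in [set: 'I_m]] `|`
             [set row_mx (v j) (const_mx (w (v j)) : 'rV[R]_1)
                | j in [set: 'I_m]]).

End Polytopes.

Section PowerSeries.
Variable R : realType.

(* A formal power series is represented by its coefficient sequence; the
   generating function of a sequence E is then E itself. *)
Definition fps_mul (f g : nat -> R) : nat -> R :=
  fun n => \sum_(i < n.+1) f i * g (n - i)%N.

Definition fps_of_poly (p : {poly R}) : nat -> R := fun n => p`_n.

(* F = h / g in R[[x]]: the denominator g is a unit of R[[x]], i.e. its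
   constant term is nonzero, and F is the power series with g * F = h. *)
Definition fps_eq_frac (F : nat -> R) (h g : {poly R}) : Prop :=
  g`_0 != 0 /\ fps_mul (fps_of_poly g) F = fps_of_poly h.

End PowerSeries.

(* Main.v *)
Require Import Defs.
From HB Require Import structures.
From mathcomp Require Import all_boot all_order all_algebra finmap.
From mathcomp Require Import mathcomp_extra boolp classical_sets functions.
From mathcomp Require Import cardinality fsbigop reals.
From mathcomp Require Import ring lra zify.

(** Let [u_j = (v_j, 1)] and let [r = d + 1] be the rank of the [u_j]. The
    lattice points of [n P] are the lattice points of height [n] of the cone
    over the [u_j], and everything rests on cutting this cone into disjoint
    half-open simplicial cones with rays among the [u_j]
    ([half_open_triangulation]).

    In one such cone, with rays [u_j], [j] in [B], every lattice point is
    uniquely a lattice point [f] of the half-open fundamental parallelepiped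
    plus a natural combination of the rays. Hence the weighted series of the
    cone is the sum over [f], of height [k] say, of
    [x^k (w f + (W - w f) x) / (1 - x)^(r + 1)], where
    [W] is the sum of the [w v_j], [j] in [B]. The coefficients of [f] lie between 0 and 1,
    so [0 <= w f <= W] and the numerator is nonnegative. It has degree at most
    [r], because [k <= r], with equality only if [f] is the sum of all the rays,
    and then [W - w f = 0]. In terms of coefficient sequences, division by
    [1 - x] is inverted by the backward difference, and the directions of the
    cone are confined to one period one after the other
    ([cone_sum_step], [cone_sum_weight], [numerator_support], [numerator_nat]).

    A numerator of degree at most [r] over [(1 - x)^(r + 1)] has a coefficient
    sequence that is polynomial from [n = 0] on, and its coefficient in degree
    [r] is a positive multiple of the sum of the numerator's coefficients
    ([bdiff_polynomial]). As these are nonnegative, the sum can vanish only if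
    the whole series does, which is excluded by a vertex of positive weight,
    a lattice point of [P] itself ([vertex_gt0]).

    The formula in terms of Ehrhart functions is a count along the fibres of
    [P_w -> P]: the points of [P_w] above [x] are those with height between 0
    and [w x], hence there are [w a + 1] lattice points above a lattice
    point [a] ([dilate_lifted], [ehrhart_lifted]). *)

Set Implicit Arguments.
Unset Strict Implicit.
Unset Printing Implicit Defensive.

Import Order.TTheory GRing.Theory Num.Theory.

Local Open Scope classical_set_scope.
Local Open Scope ring_scope.

(** * Genericity and perturbation *)

Section SmallAndGeneric.
Variable F : realFieldType.

Lemma small_perturbation (I : finType) (P : pred I) (x y : I -> F) :
  (forall i, P i -> 0 < x i) ->
  exists2 e : F, 0 < e & forall i, P i -> e * `|y i| < x i.
Proof.
move=> x_gt0; pose M := \sum_(i | P i) `|y i| / x i.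
have tge0 i : P i -> 0 <= `|y i| / x i.
  by move=> Pi; rewrite divr_ge0 ?normr_ge0 ?ltW ?x_gt0.
have M_ge0 : 0 <= M by apply: sumr_ge0.
have M1_gt0 : 0 < 1 + M by apply: ltr_pwDl.
exists (1 + M)^-1 => [|i Pi]; first by rewrite invr_gt0.
rewrite mulrC ltr_pdivrMr // -ltr_pdivrMl ?x_gt0 // mulrC.
rewrite /M (bigD1 i) //= addrCA ltrDl ltr_pwDl //.
by apply: sumr_ge0 => j /andP[Pj _]; apply: tge0.
Qed.

(** The moment curve [(1, t, t^2, ...)] meets a hyperplane through the origin in at
    most finitely many points, so one of its points avoids any finite number
    of hyperplanes. *)
Lemma moment_curve_generic (I : finType) m (P : pred I) (z : I -> 'rV[F]_m) :
  (forall i, P i -> z i != 0) ->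
  exists h : 'I_m -> F, (forall j, 0 < h j) /\
    forall i, P i -> \sum_j z i 0 j * h j != 0.
Proof.
move=> z_neq0; pose q := \prod_(i | P i) rVpoly (z i).
have q0 : q != 0.
  apply/prodf_neq0 => i /z_neq0; apply: contra_neq => /(congr1 (@poly_rV _ m)).
  by rewrite rVpolyK linear0.
have [t tgt0 qt] : exists2 t : F, 0 < t & ~~ root q t.
  have /allPn[t] : ~~ all (root q) [seq i.+1%:R : F | i <- iota 0 (size q)].
    apply/negP => /(max_poly_roots q0).
    have -> : uniq [seq i.+1%:R : F | i <- iota 0 (size q)].
      by rewrite map_inj_uniq ?iota_uniq // => a b /(mulrIn (@oner_neq0 F))[].
    by rewrite size_map size_iota ltnn => /(_ isT).
  by case/mapP => i _ -> ?; exists i.+1%:R.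
exists (fun j => t ^+ j); split=> [j|i Pi]; first exact: exprn_gt0.
apply: contra qt => /eqP zt; rewrite /root /q horner_prod.
apply/prodf_eq0; exists i => //; rewrite (@horner_coef_wide _ m) ?size_poly //.
by under eq_bigr do rewrite coef_rVpoly_ord; apply/eqP.
Qed.

End SmallAndGeneric.

(** * Bases among the rows of a matrix *)

Section Bases.
Variables (F : realFieldType) (m N : nat) (U : 'M[F]_(m, N)).
Implicit Types (B S : {set 'I_m}) (c z : 'rV[F]_m) (a g : 'rV[F]_N).

Definition supported B c := forall j, j \notin B -> c 0 j = 0.

Definition indep B := forall c, supported B c -> c *m U = 0 -> c = 0.

Definition is_basis B :=
  indep B /\ forall k, exists2 c, supported B c & row k U = c *m U.

Definition sel B : 'M[F]_m := diag_mx (\row_j (j \in B)%:R).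

(** On the row space of [U], right multiplication by this matrix computes
    coordinates in the rows of [U] indexed by [B], when these form a basis. *)
Definition coord_mx B : 'M[F]_(N, m) := pinvmx (sel B *m U) *m sel B.

Lemma mul_sel B c j : (c *m sel B) 0 j = c 0 j * (j \in B)%:R.
Proof. by rewrite mul_mx_diag !mxE. Qed.

Lemma sel_id B c : supported B c -> c *m sel B = c.
Proof.
move=> cB; apply/rowP => j; rewrite mul_sel.
by case: (boolP (j \in B)) => [|/cB ->]; rewrite ?mulr1 ?mul0r.
Qed.

Lemma coord_supported B a : supported B (a *m coord_mx B).
Proof. by move=> j jB; rewrite mulmxA mul_sel (negPf jB) mulr0. Qed.

Lemma basis_span B : is_basis B -> (U <= sel B *m U)%MS.
Proof.
case=> _ spanB; apply/row_subP => k; have [c cB ->] := spanB k.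
by rewrite -(sel_id cB) -mulmxA submxMl.
Qed.

Lemma coordK B c : is_basis B -> c *m U *m coord_mx B *m U = c *m U.
Proof.
move=> /basis_span UB; rewrite /coord_mx mulmxA -[_ *m sel B *m U]mulmxA; apply: mulmxKpV.
exact: submx_trans (submxMl _ _) UB.
Qed.

Lemma coord_uniq B c a : is_basis B -> supported B c -> a = c *m U ->
  a *m coord_mx B = c.
Proof.
move=> Bb cB ->; apply/subr0_eq/Bb.1; last by rewrite mulmxBl coordK // subrr.
by move=> j jB; rewrite mxE coord_supported // mxE cB // subrr.
Qed.

Lemma coord_row B j : is_basis B -> j \in B ->
  row j U *m coord_mx B = delta_mx 0 j.
Proof.
move=> Bb jB; apply: coord_uniq => //; last by rewrite rowE.
by move=> i iB; rewrite mxE eqxx /=; case: eqP iB => [->|]; rewrite ?jB.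
Qed.

(** A maximal independent superset spans: a row outside it is involved in a
    dependency, in which it cannot have coefficient zero. *)
Lemma indep_extend S : indep S -> exists2 B, is_basis B & S \subset B.
Proof.
move=> Sind; have [B /maxsetP[/asboolP Bind Bmax] SB] :=
  @maxset_exists _ (fun B => `[< indep B >]) S (asboolT Sind).
exists B => //; split=> // k.
case: (boolP (k \in B)) => [kB|kB].
  exists (delta_mx 0 k); last by rewrite rowE.
  by move=> i iB; rewrite mxE eqxx /=; case: eqP iB => [->|]; rewrite ?kB.
have /existsNP[z /not_implyP[zB /not_implyP[zU z0]]] : ~ indep (k |: B).
  move=> /asboolT kBind; have := Bmax _ kBind (finset.subsetUr _ _).
  by move=> eB; rewrite -eB finset.setU11 in kB.
have zk : z 0 k != 0.
  apply/eqP => zk; apply/z0/Bind => // j jB.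
  by case: (eqVneq j k) => [->//|jk]; apply: zB; rewrite !inE negb_or jk.
exists (delta_mx 0 k - (z 0 k)^-1 *: z).
  move=> j jB; rewrite !mxE eqxx /=; case: (eqVneq j k) => [->|jk].
    by rewrite mulVf // subrr.
  by rewrite (zB j) ?mulr0 ?subr0 //; rewrite in_setU1 negb_or jk.
by rewrite mulmxBl -scalemxAl zU scaler0 subr0 rowE.
Qed.

Lemma basis_card B : is_basis B -> #|B| = \rank U.
Proof.
case=> Bind spanB; pose V := rowsub (@enum_val _ (mem B)) U.
have rowV j : j \in B -> (row j U <= V)%MS.
  move=> jB; suff -> : row j U = row (enum_rank_in jB j) V by apply: row_sub.
  by apply/rowP => i; rewrite !mxE enum_rankK_in.
have -> : \rank U = \rank V.
  apply/eqP; rewrite eqn_leq; apply/andP; split; apply: mxrankS; last first.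
    by apply/row_subP => i; rewrite row_rowsub row_sub.
  apply/row_subP => k; have [c cB ->] := spanB k.
  rewrite mulmx_sum_row; apply: summx_sub => j _.
  have [jB|/cB ->] := boolP (j \in B); last by rewrite scale0r sub0mx.
  exact/scalemx_sub/rowV.
apply/esym/eqP; rewrite -/(row_free V) -kermx_eq0; apply/rowV0P => c /sub_kermxP cV.
have eV : V = rowsub (@enum_val _ (mem B)) 1%:M *m U.
  by rewrite mul_rowsub_mx mul1mx.
set c' := c *m rowsub (@enum_val _ (mem B)) 1%:M.
have c'E i : c' 0 (enum_val i) = c 0 i.
  rewrite mxE (bigD1 i) //= !mxE eqxx mulr1 big1 ?addr0 // => k ki.
  by rewrite !mxE (inj_eq enum_val_inj) (negPf ki) mulr0.
have c'0 : c' = 0.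
  apply: Bind; last by rewrite /c' -mulmxA -eV.
  move=> j jB; rewrite mxE big1 // => i _; rewrite !mxE.
  by case: eqP jB => [<-|]; rewrite ?enum_valP ?mulr0.
by apply/rowP => i; rewrite -c'E c'0 !mxE.
Qed.

End Bases.

(** * Half-open triangulation of a cone *)

Section Triangulation.
Variables (F : realFieldType) (m N : nat) (U : 'M[F]_(m, N)).
Hypothesis balanced : forall z : 'rV_m, z *m U = 0 -> \sum_j z 0 j = 0.
Implicit Types (B S : {set 'I_m}) (c z : 'rV[F]_m) (a g : 'rV[F]_N).

Definition nonneg c := forall j, 0 <= c 0 j.

Definition in_cone a := exists2 c, nonneg c & a = c *m U.

Definition cost (h : 'I_m -> F) c := \sum_j c 0 j * h j.

Lemma costD h c z : cost h (c + z) = cost h c + cost h z.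
Proof. by rewrite -big_split; apply: eq_bigr => j _; rewrite mxE mulrDl. Qed.

Lemma costZ h k c : cost h (k *: c) = k * cost h c.
Proof. by rewrite mulr_sumr; apply: eq_bigr => j _; rewrite mxE mulrA. Qed.

Definition supp c : {set 'I_m} := finset (fun j => c 0 j != 0).

Lemma supported_supp c : supported (supp c) c.
Proof. by move=> j; rewrite inE negbK => /eqP. Qed.

(** Moving along a dependency among the rows in use, in the direction that does
    not raise the cost, stays feasible until some coefficient vanishes; a
    coefficient does decrease because dependencies sum to zero. *)
Lemma cost_reduction h c : nonneg c ->
  exists c', [/\ nonneg c', c' *m U = c *m U, cost h c' <= cost h c
               & indep U (supp c')].
Proof.
have [n] := ubnP #|supp c|; elim: n c => // n IHn c lt_n c_ge0.
have [/asboolP ind|/asboolPn] := boolP `[< indep U (supp c) >].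
  by exists c.
move=> /existsNP[z0 /not_implyP[z0c /not_implyP[z0U /eqP z0neq0]]].
have [z [zc zU zneq0 hz]] : exists z, [/\ supported (supp c) z, z *m U = 0,
    z != 0 & 0 <= cost h z].
  have [hz|/ltW hz] := leP 0 (cost h z0); first by exists z0.
  (* The negative of a dependency is one as well. *)
  exists (-1 *: z0); split.
  - by move=> j /z0c e; rewrite mxE e mulr0.
  - by rewrite -scalemxAl z0U scaler0.
  - by rewrite scaleN1r oppr_eq0.
  - by rewrite costZ mulN1r oppr_ge0.
have [j0 zj0] : exists j, 0 < z 0 j.
  apply/not_existsP => zle0; case/eqP: zneq0; apply/rowP => j; rewrite mxE.
  have z_le0 i : 0 <= - z 0 i by rewrite oppr_ge0 leNgt; apply/negP/zle0.
  have := balanced zU; move/eqP; rewrite -oppr_eq0 -sumrN psumr_eq0 //.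
  by move/allP => /(_ j); rewrite mem_index_enum oppr_eq0 => /(_ isT)/eqP.
case: (@arg_minP _ _ _ j0 (fun j => 0 < z 0 j) (fun j => c 0 j / z 0 j)) => //.
move=> k zk kmin; set t := c 0 k / z 0 k in kmin.
have t_ge0 : 0 <= t by rewrite divr_ge0 // ltW.
have c't : nonneg (c - t *: z).
  move=> j; rewrite !mxE subr_ge0; have [zj|zj] := ltP 0 (z 0 j).
    by rewrite -ler_pdivlMr // kmin.
  by apply: le_trans (c_ge0 j); rewrite mulr_ge0_le0.
have [|c' [c'0 c'U c'h c'ind]] := IHn (c - t *: z) _ c't.
  rewrite ltnS in lt_n; apply: leq_trans lt_n; apply/proper_card/properP; split.
    apply/fintype.subsetP => j; rewrite !inE; apply: contra => /eqP cj.
    have zj : z 0 j = 0 by apply: zc; rewrite inE cj eqxx.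
    by rewrite !mxE cj zj mulr0 subrr.
  exists k; last by rewrite inE !mxE divfK ?subrr ?eqxx // gt_eqF.
  by rewrite inE; apply/eqP => ck; have := zc k; rewrite inE ck eqxx;
    move=> /(_ isT) e; rewrite e ltxx in zk.
exists c'; split=> //.
  by rewrite c'U mulmxBl -scalemxAl zU scaler0 subr0.
by apply: le_trans c'h _; rewrite -scaleNr costD costZ mulNr gerBl mulr_ge0.
Qed.

(** The unique dependency that expresses row [k] in the basis [B]. *)
Definition circuit B k : 'rV[F]_m := delta_mx 0 k - row k U *m coord_mx U B.

Lemma circuit_ker B k : is_basis U B -> circuit B k *m U = 0.
Proof. by move=> Bb; rewrite mulmxBl rowE coordK // subrr. Qed.

Lemma circuit_in B k : is_basis U B -> k \in B -> circuit B k = 0.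
Proof. by move=> Bb kB; rewrite /circuit coord_row // subrr. Qed.

Lemma circuit_out B k j : j \notin B -> circuit B k 0 j = (j == k)%:R.
Proof. by move=> jB; rewrite mxE mxE eqxx [X in _ + X]mxE coord_supported // oppr0 addr0. Qed.

(** Two representations of a point differ by circuits of [B], so circuits are
    all that is needed to compare costs with the representation in [B]. *)
Lemma circuit_sum B c :
  c = c *m U *m coord_mx U B + \sum_k c 0 k *: circuit B k.
Proof.
have -> : c *m U *m coord_mx U B = \sum_k c 0 k *: (row k U *m coord_mx U B).
  by rewrite (mulmx_sum_row c U) mulmx_suml; apply: eq_bigr => k _; rewrite scalemxAl.
rewrite /circuit; under [X in _ + X]eq_bigr do rewrite scalerBr.
by rewrite sumrB -row_sum_delta addrC subrK.
Qed.

(** In the language of linear programming, the reduced cost of the variable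
    [k] at the basis [B] is [cost h (circuit B k)]; positivity for all [k]
    outside [B] says that the hyperplane through the rows of [B], lifted to the
    heights [h], lies strictly below all other lifted rows. *)
Definition cell h B :=
  is_basis U B /\ forall k, k \notin B -> 0 < cost h (circuit B k).

Definition generic_cost h := forall B k, is_basis U B -> k \notin B ->
  cost h (circuit B k) != 0.

Definition generic_point g := forall B j, is_basis U B -> j \in B ->
  (g *m coord_mx U B) 0 j != 0.

Definition interior B g := forall j, j \in B -> 0 < (g *m coord_mx U B) 0 j.

(** The representation in a cell is the unique cheapest one: any other
    representation uses rows outside the cell, at positive reduced cost. Two
    cells that contain the same point in their interiors thus contain each
    other. *)
Lemma cell_uniq h B B' g : cell h B -> cell h B' ->
  g = g *m coord_mx U B *m U -> interior B g -> interior B' g -> B = B'.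
Proof.
move=> hB hB' gU.
have gcone B1 : is_basis U B1 -> g = g *m coord_mx U B1 *m U.
  by move=> B1b; rewrite gU coordK.
have main B1 B2 : cell h B1 -> cell h B2 -> interior B2 g ->
    cost h (g *m coord_mx U B1) <= cost h (g *m coord_mx U B2) ?= iff (B2 \subset B1).
  move=> [B1b B1h] [B2b _] B2g.
  set c := g *m coord_mx U B2.
  have cB2 : supported B2 c by apply: coord_supported.
  have eC : cost h c = cost h (g *m coord_mx U B1) + \sum_k c 0 k * cost h (circuit B1 k).
    rewrite {1}(circuit_sum B1 c) costD {1}/c -gcone //; congr (_ + _).
    rewrite (big_morph (cost h) (costD h) (_ : cost h 0 = 0)); last first.
      by rewrite /cost big1 // => j _; rewrite mxE mul0r.
    by apply: eq_bigr => k _; rewrite costZ.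
  have term_ge0 k : 0 <= c 0 k * cost h (circuit B1 k).
    have [kB1|kB1] := boolP (k \in B1).
      by rewrite circuit_in // /cost big1 ?mulr0 // => j _; rewrite mxE mul0r.
    apply: mulr_ge0; last exact/ltW/B1h.
    by have [kB2|/cB2 ->//] := boolP (k \in B2); exact/ltW/B2g.
  split; first by rewrite eC lerDl sumr_ge0.
  rewrite eC eq_sym -subr_eq0 addrC addKr psumr_eq0 //.
  apply/allP/fintype.subsetP => [h0 k kB2|B21 k _ /=].
    apply/negPn/negP => kB1; have := h0 k (mem_index_enum _).
    by rewrite /= mulf_eq0 !gt_eqF ?B1h // B2g.
  have [kB2|/cB2 ->] := boolP (k \in B2); last by rewrite mul0r eqxx.
  rewrite circuit_in ?B21 // /cost big1 ?mulr0 ?eqxx // => j _.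
  by rewrite mxE mul0r.
move=> Bg B'g.
have [le1 eq1] := main _ _ hB hB' B'g; have [le2 eq2] := main _ _ hB' hB Bg.
have /eqP e : cost h (g *m coord_mx U B) == cost h (g *m coord_mx U B').
  by rewrite eq_le le1 le2.
by apply/eqP; rewrite finset.eqEsubset -eq1 -eq2 e eqxx.
Qed.

(** A cheapest basis whose cone contains the point is a cell: a negative reduced
    cost would allow a small move along a circuit to a cheaper representation,
    and [cost_reduction] would turn this into a cheaper basis. Genericity of
    the point makes all coordinates positive, so that the small move is
    possible. *)
Lemma cell_exists h g : generic_cost h -> generic_point g -> in_cone g ->
  exists2 B, cell h B & interior B g.
Proof.
move=> hgen ggen [c0 c0_ge0 gE].
pose feas B := `[< is_basis U B /\ nonneg (g *m coord_mx U B) >].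
have feasible c : nonneg c -> g = c *m U ->
    exists2 B, feas B & cost h (g *m coord_mx U B) <= cost h c.
  move=> c_ge0 gc; have [c' [c'0 c'U c'h c'ind]] := cost_reduction h c_ge0.
  have [B Bb cB] := indep_extend c'ind.
  have gB : g *m coord_mx U B = c'.
    apply: coord_uniq; rewrite ?c'U // => j jB; apply: supported_supp.
    by apply: contra jB; apply: (fintype.subsetP cB).
  by exists B; [apply/asboolP; split; rewrite ?gB|rewrite gB].
have [B0 fB0 _] := feasible _ c0_ge0 gE.
case: (@arg_minP _ _ _ B0 feas (fun B => cost h (g *m coord_mx U B)) fB0).
move=> B /asboolP[Bb c_ge0] Bmin; set c := g *m coord_mx U B in c_ge0 Bmin.
have Bg : interior B g by move=> j jB; rewrite lt_neqAle eq_sym ggen //= c_ge0.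
have gc : g = c *m U by rewrite {1}gE /c gE coordK.
exists B => //; split=> // k kB; rewrite ltNge; apply/negP => rle0.
have r_lt0 : cost h (circuit B k) < 0 by rewrite lt_neqAle hgen.
have [e e_gt0 small] := small_perturbation (fun j => circuit B k 0 j) Bg.
have [||B' fB' B'h] := feasible (c + e *: circuit B k).
- move=> j; rewrite mxE [X in _ + X]mxE; have [jB|jB] := boolP (j \in B).
    have := small j jB; rewrite -/c => hs.
    have := ler_norm (- circuit B k 0 j); rewrite normrN => hn.
    have : e * - circuit B k 0 j <= e * `|circuit B k 0 j| by rewrite ler_pM2l.
    by rewrite mulrN; lra.
  by rewrite circuit_out // addr_ge0 ?mulr_ge0 ?ler0n // ltW.
- by rewrite mulmxDl -scalemxAl circuit_ker // scaler0 addr0.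
have := le_trans (Bmin _ fB') B'h.
by rewrite costD costZ lerDl leNgt nmulr_llt0 // e_gt0.
Qed.

(** A small push [q] matters only to a coordinate [p] that is zero. For a point of
    the closed simplicial cone, being pushed into the interior thus means that
    the push goes inwards through each facet that contains the point. *)
Lemma push_sign (e p q : F) : 0 < e -> q != 0 -> (p != 0 -> e * `|q| < `|p|) ->
  p + e * q != 0 /\ (0 < p + e * q <-> 0 <= p /\ (q < 0 -> 0 < p)).
Proof.
move=> e_gt0; rewrite neq_lt => /orP[q_lt0|q_gt0].
  have t_lt0 : e * q < 0 by rewrite pmulr_rlt0.
  rewrite (ltr0_norm q_lt0) mulrN; have [p_lt0|p_gt0|->] := ltgtP p 0.
  - by move=> _; split; [rewrite lt_eqF //; lra|split=> [?|[]]; lra].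
  - rewrite gtr0_norm // => /(_ isT) s.
    by split; [rewrite gt_eqF //; lra|split=> [?|?]; last lra; split=> //; exact: ltW].
  - move=> _; rewrite add0r; split; first by rewrite lt_eqF.
    by split=> [|[_ /(_ q_lt0)]]; lra.
have t_gt0 : 0 < e * q by rewrite pmulr_rgt0.
have q_nlt0 : q < 0 -> False by lra.
rewrite (gtr0_norm q_gt0); have [p_lt0|p_gt0|->] := ltgtP p 0.
- rewrite ltr0_norm // => /(_ isT) s.
  by split; [rewrite lt_eqF //; lra|split=> [|[]]; lra].
- by move=> _; split; [rewrite gt_eqF //; lra|split=> [?|?]; last lra; split=> //; exact: ltW].
- by move=> _; rewrite add0r; split; [rewrite gt_eqF|split].
Qed.

(** Membership in the simplicial cone over [B] with the facets opposite to the
    rays in [O] removed. *)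
Definition half_open_coord B (O : {set 'I_m}) c :=
  [/\ supported B c, nonneg c & forall j, j \in B -> j \in O -> 0 < c 0 j].

Definition half_open_cone B O : set 'rV[F]_N :=
  [set a | exists2 c, half_open_coord B O c & a = c *m U].

(** The cells of a generic cost function triangulate the cone. Pushing a point
    a small distance towards a generic interior point moves it into the
    interior of exactly one cell, and selects one cell among all those
    that contain it; a facet has to be removed from a cell exactly if
    the push goes outwards through it. *)
Theorem half_open_triangulation :
  exists (T : {set {set 'I_m}}) (O : {set 'I_m} -> {set 'I_m}),
    (forall B, B \in T -> is_basis U B) /\
    forall a, in_cone a -> exists2 B, B \in T /\ half_open_cone B (O B) a
      & forall B', B' \in T -> half_open_cone B' (O B') a -> B' = B.
Proof.
have [h [_ hgen]] : exists h : 'I_m -> F, (forall j, 0 < h j) /\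
    forall p : {set 'I_m} * 'I_m, `[< is_basis U p.1 >] && (p.2 \notin p.1) ->
      \sum_j circuit p.1 p.2 0 j * h j != 0.
  apply: moment_curve_generic => -[B k] /= /andP[_ kB].
  apply/eqP => /rowP/(_ k)/eqP.
  by rewrite circuit_out // eqxx mxE oner_eq0.
have {}hgen : generic_cost h.
  by move=> B k Bb kB; apply: (hgen (B, k)); rewrite kB andbT; apply/asboolP.
have [x [x_gt0 xgen]] : exists x : 'I_m -> F, (forall j, 0 < x j) /\
    forall p : {set 'I_m} * 'I_m, `[< is_basis U p.1 >] && (p.2 \in p.1) ->
      \sum_i (\row_i (row i U *m coord_mx U p.1) 0 p.2) 0 i * x i != 0.
  apply: moment_curve_generic => -[B k] /= /andP[/asboolP Bb kB].
  apply/eqP => /rowP/(_ k)/eqP.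
  by rewrite mxE coord_row // !mxE !eqxx oner_eq0.
pose xi := (\row_j x j) *m U.
have {}xgen : generic_point xi.
  move=> B j Bb jB; have := xgen (B, j); rewrite jB andbT => /(_ (asboolT Bb)).
  suff -> : (xi *m coord_mx U B) 0 j =
      \sum_i (\row_i (row i U *m coord_mx U B) 0 j) 0 i * x i by [].
  rewrite /xi (mulmx_sum_row (\row_j x j)) mulmx_suml summxE; apply: eq_bigr => i _.
  by rewrite -scalemxAl !mxE mulrC.
pose T : {set {set 'I_m}} := finset (fun B => `[< cell h B >]).
pose O B : {set 'I_m} := finset (fun j => (xi *m coord_mx U B) 0 j < 0).
have TP B : B \in T -> cell h B by rewrite inE => /asboolP.
exists T, O; split=> [B /TP[]//|a [c c_ge0 ac]].
have coU B c' : is_basis U B -> a = c' *m U -> a *m coord_mx U B *m U = a.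
  by move=> Bb ->; rewrite coordK.
have [e e_gt0 small] := @small_perturbation F _
  (fun p : {set 'I_m} * 'I_m => (a *m coord_mx U p.1) 0 p.2 != 0)
  (fun p => `|(a *m coord_mx U p.1) 0 p.2|) (fun p => (xi *m coord_mx U p.1) 0 p.2)
  (fun p => eqbRL (normr_gt0 _)).
pose g := a + e *: xi.
have gE B j : (g *m coord_mx U B) 0 j =
    (a *m coord_mx U B) 0 j + e * (xi *m coord_mx U B) 0 j.
  by rewrite mulmxDl -scalemxAl mxE [X in _ + X]mxE.
have gsign B j : is_basis U B -> j \in B -> (g *m coord_mx U B) 0 j != 0 /\
    (0 < (g *m coord_mx U B) 0 j <->
     0 <= (a *m coord_mx U B) 0 j /\ (j \in O B -> 0 < (a *m coord_mx U B) 0 j)).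
  move=> Bb jB; rewrite gE inE; apply: push_sign => //; first exact: xgen.
  exact: (small (B, j)).
have gcone : in_cone g.
  exists (c + e *: \row_j x j); last by rewrite mulmxDl -scalemxAl -ac.
  by move=> j; rewrite !mxE addr_ge0 // mulr_ge0 // ltW.
have ggen : generic_point g by move=> B j Bb jB; have [] := gsign B j Bb jB.
have gH B : is_basis U B -> half_open_cone B (O B) a <-> interior B g.
  move=> Bb; have gpos j jB := (gsign B j Bb jB).2.
  split=> [[c' [c'B c'0 c'O] ac'] j jB|gB].
    apply/gpos => //; rewrite (coord_uniq Bb c'B ac'); split=> // jO.
    exact: c'O.
  exists (a *m coord_mx U B); last by rewrite (coU _ c).
  split; first exact: coord_supported.
    move=> j; have [jB|/(coord_supported U a) ->//] := boolP (j \in B).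
    by have /gpos[] := gB j jB.
  by move=> j jB; have [_] := (gpos j jB).1 (gB j jB).
have [B hB Bg] := cell_exists hgen ggen gcone.
exists B; first by split; [rewrite inE; apply/asboolP|apply/gH => //; case: hB].
move=> B' /TP hB' /(gH _ hB'.1) B'g.
apply: (cell_uniq hB' hB) B'g Bg; case: gcone => c' _ ->.
by rewrite coordK //; case: hB'.
Qed.

End Triangulation.

(** * Backward differences of sequences *)

Section BackwardDifference.
Variable V : zmodType.
Implicit Types f g : nat -> V.

Definition shift f n := if n is n'.+1 then f n' else 0.

Definition bdiff f n := f n - shift f n.

Lemma bdiff_add f g : bdiff (f \+ g) = bdiff f \+ bdiff g.
Proof. by apply/funext => -[|n]; rewrite /bdiff /= ?subr0 // opprD addrACA. Qed.

Lemma iter_bdiff_add k f g :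
  iter k bdiff (f \+ g) = iter k bdiff f \+ iter k bdiff g.
Proof. by elim: k => //= k ->; rewrite bdiff_add. Qed.

Lemma iter_bdiff_sum (I : finType) (P : pred I) k (f : I -> nat -> V) :
  iter k bdiff (fun n => \sum_(i | P i) f i n) =
  fun n => \sum_(i | P i) iter k bdiff (f i) n.
Proof.
elim: k => //= k ->; apply/funext => -[|n]; rewrite /bdiff /= ?subr0.
  by apply: eq_bigr => i _; rewrite subr0.
by rewrite -sumrB.
Qed.

Lemma iter_bdiff_shift k f : iter k bdiff (shift f) = shift (iter k bdiff f).
Proof. by elim: k => //= k ->; apply/funext => -[|n]; rewrite /bdiff /= ?subr0. Qed.

Lemma bdiff_inj : injective bdiff.
Proof.
move=> f g fg; apply/funext; elim=> [|n IHn].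
  by have /(congr1 (@^~ 0%N)) := fg; rewrite /bdiff /= !subr0.
by have /(congr1 (@^~ n.+1)) := fg; rewrite /bdiff /= IHn => /addIr.
Qed.

Lemma iter_bdiff_inj k : injective (iter k bdiff).
Proof. by elim: k => // k IHk f g /= /bdiff_inj/IHk. Qed.

End BackwardDifference.

Lemma iter_bdiff_scale (A : pzRingType) k (a : A) f :
  iter k (@bdiff A) (fun n => a * f n) = fun n => a * iter k (@bdiff A) f n.
Proof.
by elim: k => //= k ->; apply/funext => -[|n]; rewrite /bdiff /= ?subr0 // mulrBr.
Qed.

(** * Weighted lattice points of a half-open simplicial cone *)

Section SimplicialCount.
Variables (F : archiRealFieldType) (m : nat) (B O : {set 'I_m}).
Variable L : set 'rV[F]_m.
Hypothesis L_translate :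
  forall c j, j \in B -> L (c + delta_mx 0 j) <-> L c.
Implicit Types (J : {set 'I_m}) (c : 'rV[F]_m) (g : 'rV[F]_m -> F).

(** One period of the coordinate [j] in the half-open cone: [0 < x <= 1] if the
    facet [x = 0] is removed and [0 <= x < 1] otherwise. *)
Definition window j (x : F) := if j \in O then x <= 1 else x < 1.

(** The points of degree [n] of a half-open simplicial cone, written in the
    coordinates given by its rays; the directions in [J] are confined to
    one period, so that [J = B] gives the half-open parallelepiped. *)
Definition cone_points J n : set 'rV[F]_m :=
  [set c | [/\ half_open_coord B O c, L c, \sum_j c 0 j = n%:R
             & forall j, j \in J -> window j (c 0 j)]].

Hypothesis finite_points : forall n, finite_set (cone_points finset.set0 n).

Definition cone_sum J g n := \sum_(c \in cone_points J n) g c.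

Lemma finite_cone_points J n : finite_set (cone_points J n).
Proof.
apply: sub_finite_set (finite_points n) => c [cBO cL cn _]; split=> // j.
by rewrite finset.in_set0.
Qed.

(** A point of the cone is outside the window of [j] exactly if one can subtract
    the ray [j] without leaving the cone. *)
Lemma cone_points_add J n j : j \in B -> j \notin J ->
  set_bij (cone_points J n)
    (cone_points J n.+1 `&` [set c : 'rV_m | ~ window j (c 0 j)])
    (+%R^~ (delta_mx 0 j)).
Proof.
move=> jB jJ.
have dE (c : 'rV[F]_m) i : (c + delta_mx 0 j) 0 i = c 0 i + (i == j)%:R.
  by rewrite !mxE eqxx.
have sumE (c : 'rV[F]_m) : \sum_i (c + delta_mx 0 j) 0 i = \sum_i c 0 i + 1.
  under eq_bigr do rewrite dE; rewrite big_split /=; congr (_ + _).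
  by rewrite (bigD1 j) //= eqxx big1 ?addr0 // => i /negPf ->.
split.
- move=> c [[cB c0 cO] cL cn cJ]; split; last first.
    rewrite /= dE eqxx /window; case: ifP => jO; apply/negP.
      by rewrite -ltNge ltrDr cO.
    by rewrite -leNgt lerDr c0.
  split; [split| | |].
  + move=> i iB; rewrite dE cB //; case: eqP iB => [->|]; first by rewrite jB.
    by rewrite addr0.
  + by move=> i; rewrite dE addr_ge0 // ler0n.
  + by move=> i iB iO; rewrite dE ltr_wpDr ?ler0n ?cO.
  + exact/L_translate.
  + by rewrite sumE cn -natr1.
  + move=> i iJ; rewrite dE; case: eqP iJ => [->|_ /cJ]; last by rewrite addr0.
    by rewrite (negPf jJ).
- by move=> c c' _ _ /addIr.
- move=> c [[[cB c0 cO] cL cn cJ] cj]; exists (c - delta_mx 0 j); last by rewrite subrK.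
  have cE i : (c - delta_mx 0 j) 0 i = c 0 i - (i == j)%:R by rewrite !mxE eqxx.
  have [cj1 cj1O] : 1 <= c 0 j /\ (j \in O -> 1 < c 0 j).
    move: cj; rewrite /= /window; case: (j \in O) => /negP; rewrite -?ltNge -?leNgt => cj.
      by split=> //; apply: ltW.
    by split.
  split; [split| | |].
  + move=> i iB; rewrite cE cB //; case: eqP iB => [->|]; first by rewrite jB.
    by rewrite subr0.
  + by move=> i; rewrite cE; case: eqP => [->|_]; rewrite ?subr_ge0 ?subr0.
  + move=> i iB iO; rewrite cE; case: eqP iO => [-> /cj1O|_]; first by rewrite subr_gt0.
    by rewrite subr0; apply: cO.
  + by apply/(L_translate _ jB); rewrite subrK.
  + by apply: (addIr 1); rewrite -sumE subrK cn natr1.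
  + move=> i iJ; rewrite cE; case: eqP iJ => [->|_ /cJ]; last by rewrite subr0.
    by rewrite (negPf jJ).
Qed.

Lemma cone_sum_step J g j : j \in B -> j \notin J ->
  bdiff (cone_sum J g) = cone_sum (j |: J) g \+
    shift (cone_sum J (fun c => g (c + delta_mx 0 j) - g c)).
Proof.
move=> jB jJ; apply/funext => n; rewrite /bdiff /=.
have split_n : cone_sum J g n = cone_sum (j |: J) g n +
    \sum_(c \in cone_points J n `&` [set c : 'rV_m | ~ window j (c 0 j)]) g c.
  rewrite {1}/cone_sum (fsbigID [set c : 'rV_m | window j (c 0 j)]); last exact: finite_cone_points.
  congr (_ + _); congr (\sum_(c \in _) g c); apply/seteqP; split=> c.
    move=> [[cBO cL cn cJ] cj]; split=> // i.
    by rewrite finset.in_setU1 => /orP[/eqP ->//|/cJ].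
  move=> [cBO cL cn cJ]; split; last by apply: cJ; rewrite finset.setU11.
  by split=> // i iJ; apply: cJ; rewrite finset.in_setU1 iJ orbT.
rewrite split_n; case: n split_n => [|n] _ /=.
  (* In degree zero only the origin occurs, which is in every window. *)
  rewrite subr0; congr (_ + _); apply: fsbig1 => c [[[cB c0 cO] _ cn _]].
  have : c 0 j = 0.
    apply/eqP; move/eqP: cn; rewrite psumr_eq0 // => /allP/(_ j).
    by rewrite mem_index_enum => /(_ isT).
  by rewrite /= /window => ->; case: ifP => _; rewrite ?ler01 ?ltr01.
rewrite (reindex_fsbig _ _ _ _ (cone_points_add n jB jJ)) -addrA; congr (_ + _).
rewrite /cone_sum !fsbig_finite; try exact: finite_cone_points.
by rewrite -sumrB.
Qed.

Variable w : {scalar 'rV[F]_m}.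

Lemma weight_coord c : w c = \sum_j c 0 j * w (delta_mx 0 j).
Proof. by rewrite {1}(row_sum_delta c) linear_sum; apply: eq_bigr => j _; rewrite linearZ. Qed.

Let W := \sum_(j in B) w (delta_mx 0 j).

(** The coefficients of the sum of [x^n (w c + (W - w c) x)] over the points [c]
    of the parallelepiped, [n] being the degree of [c]. *)
Definition numerator : nat -> F :=
  cone_sum B w \+ shift (cone_sum B (fun c => W - w c)).

(** A unit step along the ray [j] raises the weight by a constant, so that
    confining one more direction to its window costs one difference for the
    number of points, and leaves a multiple of this number for the weight. *)
Lemma cone_sum_weight : iter #|B|.+1 (@bdiff F) (cone_sum finset.set0 w) = numerator.
Proof.
have main k J : J \subset B -> #|B :\: J| = k ->
    iter k (@bdiff F) (cone_sum J (fun=> 1)) = cone_sum B (fun=> 1) /\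
    iter k.+1 (@bdiff F) (cone_sum J w) = bdiff (cone_sum B w) \+
      shift (fun n => (\sum_(j in B :\: J) w (delta_mx 0 j)) * cone_sum B (fun=> 1) n).
  elim: k J => [|k IHk] J JB cardJ.
    have BJ : B :\: J = finset.set0 by apply/eqP; rewrite -cards_eq0 cardJ.
    have <- : J = B by apply/eqP; rewrite finset.eqEsubset JB -finset.setD_eq0 BJ eqxx.
    split=> //; apply/funext => -[|n] /=; rewrite ?addr0 //.
    by rewrite finset.setDv big_set0 mul0r addr0.
  have [j] : exists j, j \in B :\: J by apply/finset.set0Pn; rewrite -card_gt0 cardJ.
  rewrite inE => /andP[jJ jB].
  have jJB : j |: J \subset B by rewrite finset.subUset finset.sub1set jB JB.
  have BjJ : B :\: (j |: J) = (B :\: J) :\ j.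
    by apply/finset.setP => i; rewrite !inE negb_or andbA.
  have [|IH1 IHw] := IHk _ jJB.
    by move: cardJ; rewrite (cardsD1 j) !inE jJ jB BjJ => -[].
  have step1 : bdiff (cone_sum J (fun=> 1)) = cone_sum (j |: J) (fun=> 1).
    rewrite (cone_sum_step _ jB jJ); apply/funext => -[|n] /=; first by rewrite addr0.
    by rewrite [X in _ + X]fsbig1 ?addr0 // => c _; rewrite subrr.
  have stepw : bdiff (cone_sum J w) = cone_sum (j |: J) w \+
      shift (fun n => w (delta_mx 0 j) * cone_sum J (fun=> 1) n).
    rewrite (cone_sum_step _ jB jJ); apply/funext => -[|n] //=; congr (_ + _).
    rewrite /cone_sum mulr_fsumr; apply: eq_fsbigr => c _.
    by rewrite linearD /= mulr1 addrC addKr.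
  split; first by rewrite iterSr step1 IH1.
  rewrite iterSr stepw iter_bdiff_add IHw iter_bdiff_shift iter_bdiff_scale.
  rewrite iterSr step1 IH1; apply/funext => n /=; rewrite -addrA; congr (_ + _).
  case: n => [|n] /=; first by rewrite addr0.
  rewrite BjJ [in RHS](big_setD1 j) ?inE ?jJ ?jB //= mulrDl addrC; congr (_ + _).
have [_ ->] := main _ finset.set0 (finset.sub0set B) (congr1 (fun X : {set _} => #|X|) (finset.setD0 B)).
apply/funext => -[|n]; rewrite /numerator /bdiff /= ?subr0 // -addrA; congr (_ + _).
rewrite finset.setD0 /cone_sum mulr_fsumr !fsbig_finite; try exact: finite_cone_points.
rewrite -sumrN -big_split /=; apply: eq_bigr => c _.
by rewrite mulr1 addrC.
Qed.

Lemma half_open_sum n c : cone_points B n c -> \sum_(j in B) (1 - c 0 j) = #|B|%:R - n%:R.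
Proof.
move=> [[cB _ _] _ cn _]; rewrite sumrB sumr_const -cn; congr (_ - _).
rewrite [RHS](bigID (mem B)) /= [X in _ + X]big1 ?addr0 // => j /cB.
Qed.

Lemma complement_weight n c : cone_points B n c ->
  W - w c = \sum_(j in B) (1 - c 0 j) * w (delta_mx 0 j).
Proof.
move=> [[cB _ _] _ _ _]; under eq_bigr do rewrite mulrBl mul1r.
rewrite sumrB; congr (_ - _); rewrite weight_coord (bigID (mem B)) /=.
by rewrite [X in _ + X]big1 ?addr0 // => j /cB ->; rewrite mul0r.
Qed.

Lemma cone_points_le1 n c j : cone_points B n c -> j \in B -> c 0 j <= 1.
Proof. by move=> [_ _ _ cJ] /cJ; rewrite /window; case: ifP => // _ /ltW. Qed.

(** In degree [#|B|.+1] only the term [W - w c] can contribute, for points [c] of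
    degree [#|B|]. All coordinates of such a point are 1, whence [w c = W]. *)
Lemma numerator_support n : (#|B| < n)%N -> numerator n = 0.
Proof.
have empty k : (#|B| < k)%N -> forall c, cone_points B k c -> False.
  move=> Bk c ck; have := half_open_sum ck; have : 0 <= \sum_(j in B) (1 - c 0 j).
    by apply: sumr_ge0 => j jB; rewrite subr_ge0 (cone_points_le1 ck).
  by move=> s e; move: s; rewrite e subr_ge0 ler_nat leqNgt Bk.
case: n => // n Bn; rewrite /numerator /= /cone_sum fsbig1 => [|c /(empty _ Bn)//].
rewrite add0r; apply: fsbig1 => c cn.
have [nB|nB] := ltnP #|B| n; first by have := empty _ nB c cn.
have {nB} en : n = #|B| by apply/eqP; rewrite eqn_leq nB -ltnS Bn.
have := half_open_sum cn; rewrite en subrr => /eqP; rewrite psumr_eq0; last first.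
  by move=> j jB; rewrite subr_ge0 (cone_points_le1 cn).
move=> /allP c1; rewrite (complement_weight cn) big1 // => j jB.
by have := c1 j (mem_index_enum _); rewrite jB => /eqP ->; rewrite mul0r.
Qed.

Hypothesis w_nat : forall c, L c -> nonneg c -> w c \is a Num.nat.
Hypothesis w_ray : forall j, j \in B -> w (delta_mx 0 j) \is a Num.nat.

Lemma numerator_nat n : numerator n \is a Num.nat.
Proof.
have sum_nat (f : 'rV[F]_m -> F) k : (forall c, cone_points B k c -> f c \is a Num.nat) ->
    cone_sum B f k \is a Num.nat.
  move=> fnat; rewrite /cone_sum fsbig_finite; last exact: finite_cone_points.
  rewrite big_seq; apply: rpred_sum => c; rewrite in_fset_set ?inE; first exact: fnat.
  exact: finite_cone_points.
rewrite /numerator /= rpredD //.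
  by apply: sum_nat => c [[_ c0 _] cL _ _]; apply: w_nat.
case: n => [|n] /=; first exact: rpred0.
apply: sum_nat => c cn; rewrite natrEint; apply/andP; split; last first.
  rewrite (complement_weight cn); apply: sumr_ge0 => j jB.
  by apply: mulr_ge0; [rewrite subr_ge0 (cone_points_le1 cn)|apply/natr_ge0/w_ray].
case: cn => [[_ c0 _] cL _ _]; rewrite rpredB //; last by rewrite intr_nat // w_nat.
by apply: rpred_sum => j jB; rewrite intr_nat // w_ray.
Qed.

End SimplicialCount.

(** * Rational generating functions and polynomials *)

Section RationalSeries.
Variable R : realType.

Lemma fps_mul_1subX (q : {poly R}) f :
  fps_mul (fps_of_poly ((1 - 'X) * q)) f = bdiff (fps_mul (fps_of_poly q) f).
Proof.
apply/funext => n; rewrite /fps_mul /fps_of_poly /bdiff mulrBl mul1r.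
under eq_bigr do rewrite coefB coefXM mulrBl.
rewrite sumrB; congr (_ - _); rewrite big_ord_recl /= mul0r add0r.
by case: n => [|n]; rewrite ?big_ord0.
Qed.

Lemma fps_mul_1subX_exp k f :
  fps_mul (fps_of_poly ((1 - 'X) ^+ k)) f = iter k (@bdiff R) f.
Proof.
elim: k => [|k IHk]; last by rewrite exprS fps_mul_1subX IHk.
apply/funext => n; rewrite /fps_mul /fps_of_poly expr0 big_ord_recl coef1 mul1r.
by rewrite big1 ?addr0 ?subn0 // => i _; rewrite coef1 mul0r.
Qed.

(** The coefficient of [x^n] in [x^k / (1 - x)^(r + 1)]. *)
Definition binomial_term r k n : R := if (k <= n)%N then 'C(n - k + r, r)%:R else 0.

Lemma iter_bdiff_binomial r k :
  iter r.+1 (@bdiff R) (binomial_term r k) = fun n => (n == k)%:R.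
Proof.
elim: r => [|r IHr]; last first.
  rewrite iterSr; rewrite -[RHS]IHr; congr (iter _ _ _); apply/funext => n.
  rewrite /bdiff /binomial_term; case: n => [|n] /=.
    by rewrite subr0 sub0n !add0n !binn.
  have [kn|nk|->] := ltngtP k n.+1.
  - by rewrite -ltnS kn subSn // addSn addnS binS natrD addrAC subrr add0r.
  - by rewrite leqNgt (ltnW nk) /= subrr.
  - by rewrite ltnn subnn !add0n !binn subr0.
apply/funext => -[|n]; rewrite /= /bdiff /binomial_term !bin0.
  by rewrite subr0 leqn0 eq_sym; case: eqP.
have [kn|nk|->] := ltngtP k n.+1.
- by rewrite /= -ltnS kn bin0 subrr.
- by rewrite /= leqNgt (ltnW nk) /= subrr.
- by rewrite /= ltnn subr0.
Qed.

(** For [n < k <= r] the polynomial vanishes at [n], in accordance with the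
    value zero of the coefficient. *)
Lemma binomial_term_horner r k n : (k <= r)%N ->
  binomial_term r k n =
  (r`!%:R^-1 *: \prod_(i < r) ('X - (k%:R + i%:R - r%:R)%:P) : {poly R}).[n%:R].
Proof.
move=> kr; have -> : binomial_term r k n = 'C(n + r - k, r)%:R.
  rewrite /binomial_term; case: leqP => kn; first by rewrite addnBAC.
  by rewrite bin_small //; lia.
rewrite hornerZ horner_prod; apply: (canRL (mulKf _)).
  by rewrite pnatr_eq0 -lt0n fact_gt0.
rewrite -natrM mulnC bin_ffact.
have kle : (k <= n + r)%N by apply: leq_trans kr _; rewrite leq_addl.
have [nkr|nkr] := leqP r (n + r - k); last first.
  rewrite ffact_small // (bigD1 (Ordinal nkr)) //= !hornerE natrB // natrD.
  by rewrite [X in X * _](_ : _ = 0) ?mul0r //; ring.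
rewrite ffact_prod natr_prod; apply: eq_bigr => i _; rewrite !hornerE.
have iN : (i <= n + r - k)%N by apply: leq_trans nkr; apply: ltnW.
by rewrite !natrB // natrD; ring.
Qed.

(** The inverse of [(1 - X) ^+ r.+1] has binomial coefficients, polynomials in
    [n] of degree [r] with leading coefficient [1 / r`!]. A numerator of degree
    at most [r] makes these polynomial formulas valid for all [n], including
    the first few. *)
Lemma bdiff_polynomial r (f h : nat -> R) :
  iter r.+1 (@bdiff R) f = h -> (forall n, (r < n)%N -> h n = 0) ->
  exists p : {poly R}, [/\ (size p <= r.+1)%N, p`_r = (\sum_(k < r.+1) h k) / r`!%:R
    & forall n, f n = p.[n%:R]].
Proof.
move=> fh h0.
have fE : f = fun n => \sum_(k < r.+1) h k * binomial_term r k n.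
  apply: (@iter_bdiff_inj R r.+1); rewrite fh iter_bdiff_sum; apply/funext => n.
  under eq_bigr do rewrite iter_bdiff_scale iter_bdiff_binomial.
  have [nr|rn] := ltnP n r.+1.
    rewrite (bigD1 (Ordinal nr)) //= eqxx mulr1 big1 ?addr0 // => k kn.
    by case: eqP => e; rewrite ?mulr0 //; case/eqP: kn; apply: val_inj.
  rewrite h0 // big1 // => k _; case: eqP => e; rewrite ?mulr0 //.
  by have := ltn_ord k; rewrite -e ltnNge rn.
pose Q k : {poly R} := \prod_(i < r) ('X - (k%:R + i%:R - r%:R)%:P).
have sQ k : size (Q k) = r.+1.
  by rewrite size_prod_XsubC /index_enum -enumT size_enum_ord.
exists (\sum_(k < r.+1) h k *: (r`!%:R^-1 *: Q k)); split.
- apply: leq_trans (size_sum _ _ _) _; apply/bigmax_leqP => k _.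
  by rewrite scalerA (leq_trans (size_scale_leq _ _)) ?sQ.
- rewrite coef_sum mulr_suml; apply: eq_bigr => k _; rewrite !coefZ; congr (_ * _).
  have /monicP : Q k \is monic by apply: monic_prod_XsubC.
  by rewrite lead_coefE sQ /= => ->; rewrite mulr1.
- move=> n; rewrite fE horner_sum; apply: eq_bigr => k _.
  by rewrite [in RHS]hornerZ -binomial_term_horner // -ltnS.
Qed.

End RationalSeries.

(** * The weighted series of a graded cone *)

Section ConeSeries.
Variables (F : archiRealFieldType) (m N : nat) (U : 'M[F]_(m, N)).
Variables (deg : 'rV[F]_N -> F) (w : {scalar 'rV[F]_N}) (L : set 'rV[F]_N).
Hypothesis deg_mul : forall c, deg (c *m U) = \sum_j c 0 j.
Hypothesis L_translate : forall a j, L (a + row j U) <-> L a.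

Definition level n : set 'rV[F]_N := [set a | [/\ in_cone U a, L a & deg a = n%:R]].

Hypothesis finite_level : forall n, finite_set (level n).
Hypothesis w_nat : forall a, L a -> in_cone U a -> w a \is a Num.nat.
Hypothesis w_ray : forall j, w (row j U) \is a Num.nat.

(** The weighted sum over a level of the cone splits over the half-open cells,
    all of which have [\rank U] rays. *)
Theorem cone_series : exists h : nat -> F,
  [/\ forall n, h n \is a Num.nat, forall n, (\rank U < n)%N -> h n = 0
    & iter (\rank U).+1 (@bdiff F) (fun n => \sum_(a \in level n) w a) = h].
Proof.
have balanced (z : 'rV_m) : z *m U = 0 -> \sum_j z 0 j = 0.
  move=> zU; rewrite -deg_mul zU -(mul0mx _ U) deg_mul.
  by apply: big1 => j _; rewrite mxE.
have [T [O [TB Tuniq]]] := half_open_triangulation balanced.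
(* Points of a cell are replaced by their coordinates in its rays. *)
pose LU : set 'rV_m := [set c | L (c *m U)].
pose wU : {scalar 'rV[F]_m} := w \o mulmxr U.
have wUray j : wU (delta_mx 0 j) = w (row j U) by rewrite /= -rowE.
have LUt (B : {set 'I_m}) (c : 'rV_m) j : j \in B -> LU (c + delta_mx 0 j) <-> LU c.
  by move=> _; rewrite /LU /= mulmxDl -rowE.
have bij B n : B \in T -> set_bij (cone_points B (O B) LU finset.set0 n)
    (level n `&` half_open_cone U B (O B)) (mulmx^~ U).
  move=> BT; split.
  - move=> c [cBO cL cn _]; split; last by exists c.
    split=> //; last by rewrite deg_mul.
    by exists c => //; case: cBO.
  - move=> c c' /set_mem[[cB _ _] _ _ _] /set_mem[[c'B _ _] _ _ _] e.
    have Bb := TB B BT.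
    by rewrite -(coord_uniq Bb cB (erefl _)) e (coord_uniq Bb c'B (erefl _)).
  - move=> a [[_ aL an] [c cBO ac]]; exists c => //; split=> //.
    + by rewrite /LU /= -ac.
    + by rewrite -deg_mul -ac.
    + by move=> j; rewrite finset.in_set0.
have fin B n : B \in T -> finite_set (cone_points B (O B) LU finset.set0 n).
  move=> BT; have := finite_image (mulmx^~ (coord_mx U B)) (finite_level n).
  apply: sub_finite_set => c cP; have [im _ _] := bij B n BT.
  have [aL _] := im c cP; exists (c *m U) => //.
  by case: cP => -[cB _ _] _ _ _; apply: coord_uniq => //; apply: TB.
pose h n := \sum_(B in T) numerator B (O B) LU wU n.
exists h; split=> [n|n rn|].
- apply: rpred_sum => B BT; apply: numerator_nat => //.
  + by move=> k; exact: fin.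
  + by move=> c cL c0; apply: w_nat => //; exists c.
  + by move=> j _; rewrite wUray.
- apply: big1 => B BT; apply: numerator_support.
  by rewrite (basis_card (TB B BT)).
rewrite /h (_ : (fun n => _) = fun n => \sum_(B in T) cone_sum B (O B) LU finset.set0 wU n).
  rewrite iter_bdiff_sum; apply/funext => n; apply: eq_bigr => B BT.
  rewrite -(cone_sum_weight (@LUt B)) ?(basis_card (TB B BT)) // => k; exact: fin.
apply/funext => n.
transitivity (\sum_(B in T) \sum_(a \in level n)
    if a \in half_open_cone U B (O B) then w a else 0).
  rewrite fsbig_finite //; under [RHS]eq_bigr do rewrite fsbig_finite //.
  rewrite exchange_big /= !big_seq; apply: eq_bigr => a.
  rewrite in_fset_set // inE => -[aU _ _].
  have [B [BT aB] Buniq] := Tuniq a aU.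
  rewrite (bigD1 B) //= mem_set // big1 ?addr0 // => B' /andP[B'T B'B].
  by case: ifP => // /set_mem/(Buniq _ B'T) e; rewrite e eqxx in B'B.
apply: eq_bigr => B BT; rewrite -fsbig_mkcondr.
by rewrite (reindex_fsbig _ _ _ _ (bij B n BT)).
Qed.

End ConeSeries.

(** * Dilates of a polytope as levels of a cone *)

Section Homogenization.
Variables (R : realType) (s m : nat) (v : 'I_m -> 'rV[R]_s).

Let P := conv_hull (range v).
Let V : 'M[R]_(m, s) := \matrix_j v j.

Lemma conv_hull_rangeP x :
  P x <-> exists2 c : 'rV_m, nonneg c /\ \sum_j c 0 j = 1 & x = c *m V.
Proof.
split=> [[k [p [c [pv c0 c1 ->]]]]|[c [c0 c1] ->]]; last first.
  exists m, v, (c 0); split=> //.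
  by rewrite mulmx_sum_row; apply: eq_bigr => j _; rewrite rowK.
have [f fE] : {f : 'I_k -> 'I_m & forall i, v (f i) = p i}.
  by apply: (@choice _ _ (fun i j => v j = p i)) => i; have [j _ <-] := pv i; exists j.
exists (\sum_i c i *: delta_mx 0 (f i)); first split.
- by move=> j; rewrite summxE; apply: sumr_ge0 => i _; rewrite !mxE mulr_ge0 ?ler0n.
- under eq_bigr do rewrite summxE.
  rewrite exchange_big -c1; apply: eq_bigr => i _.
  rewrite (bigD1 (f i)) //= big1 => [|j /negPf jf]; first by rewrite !mxE !eqxx mulr1 addr0.
  by rewrite !mxE jf mulr0.
- by rewrite mulmx_suml; apply: eq_bigr => i _; rewrite -scalemxAl -rowE rowK fE.
Qed.

Definition homogenize : 'M[R]_(m, s + 1) := row_mx V (const_mx 1).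

Lemma mul_homogenize c :
  c *m homogenize = row_mx (c *m V) (\sum_j c 0 j)%:M.
Proof.
rewrite mul_mx_row; congr row_mx; apply/matrixP => i j.
by rewrite !ord1 !mxE eqxx; apply: eq_bigr => k _; rewrite mxE mulr1.
Qed.

Lemma row_homogenize j : row j homogenize = row_mx (v j) 1%:M.
Proof.
rewrite row_row_mx rowK; congr row_mx; apply/matrixP => i k.
by rewrite !ord1 !mxE.
Qed.

(** For [n = 0] both sides single out the origin; this needs a vertex, as the
    dilates of the empty set are empty. *)
Lemma dilate_in_cone n a : (0 < m)%N ->
  dilate n P a <-> in_cone homogenize (row_mx a (n%:R%:M : 'M_1)).
Proof.
move=> m_gt0; split.
  move=> [x /conv_hull_rangeP[c [c0 c1] ->] <-]; exists (n%:R *: c).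
    by move=> j; rewrite mxE mulr_ge0 ?ler0n.
  rewrite mul_homogenize -scalemxAl; congr (row_mx _ _%:M).
  by under eq_bigr do rewrite mxE; rewrite -mulr_sumr c1 mulr1.
move=> [c c0]; rewrite mul_homogenize => /eq_row_mx[-> /(congr1 (fun M : 'M_1 => M 0 0))].
rewrite !mxE eqxx !mulr1n => sumc; case: n sumc => [|n] sumc.
  exists (v (Ordinal m_gt0)).
    by exists 1%N, (fun=> v (Ordinal m_gt0)), (fun=> 1); rewrite !big_ord1 scale1r.
  suff -> : c = 0 by rewrite scale0r mul0mx.
  apply/rowP => j; rewrite mxE; apply/eqP; move/esym/eqP: sumc.
  by rewrite psumr_eq0 // => /allP/(_ j (mem_index_enum _)).
exists (n.+1%:R^-1 *: (c *m V)); last by rewrite scalerA divff ?scale1r ?pnatr_eq0.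
apply/conv_hull_rangeP; exists (n.+1%:R^-1 *: c); last by rewrite scalemxAl.
split=> [j|]; first by rewrite mxE mulr_ge0 ?invr_ge0 ?ler0n.
by under eq_bigr do rewrite mxE; rewrite -mulr_sumr -sumc mulVf ?pnatr_eq0.
Qed.

Lemma affine_hull_homogenize x :
  affine_hull P x -> (row_mx x 1%:M <= homogenize)%MS.
Proof.
move=> [k [p [c [pP c1 ->]]]].
have -> : row_mx (\sum_i c i *: p i) 1%:M = \sum_i c i *: row_mx (p i) 1%:M :> 'rV_(s + 1).
  under [RHS]eq_bigr do rewrite scale_row_mx scale_scalar_mx mulr1.
  rewrite -c1; elim/big_rec3: _ => [|i y1 y2 y3 _ <-]; first by rewrite raddf0 row_mx0.
  by rewrite add_row_mx raddfD.
apply: summx_sub => i _; apply: scalemx_sub.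
have /conv_hull_rangeP[d [_ d1] ->] := pP i.
by rewrite -d1 -mul_homogenize submxMl.
Qed.

Lemma sub_affine_hull x : P x -> affine_hull P x.
Proof. by move=> Px; exists 1%N, (fun=> x), (fun=> 1); rewrite !big_ord1 scale1r. Qed.

Lemma vertex_in_hull j : P (v j).
Proof. by exists 1%N, (fun=> v j), (fun=> 1); rewrite !big_ord1 scale1r; split. Qed.

(** An affine basis of the affine hull, put at height one, becomes a linear
    basis of the span of the cone. *)
Lemma rank_homogenize d : has_dim P d -> \rank homogenize = d.+1.
Proof.
move=> [x0 [W [affE <-]]].
pose Bm : 'M[R]_(\dim W, s) := \matrix_i (vbasis W)`_i.
pose M : 'M[R]_(\dim W + 1, s + 1) := col_mx (row_mx Bm 0) (row_mx x0 1%:M).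
have affP x : affine_hull P x <-> x - x0 \in W by rewrite affE.
have MU : (M <= homogenize)%MS.
  have x0U : (row_mx x0 1%:M <= homogenize)%MS.
    by apply: affine_hull_homogenize; apply/affP; rewrite subrr mem0v.
  rewrite col_mx_sub x0U andbT; apply/row_subP => i.
  rewrite row_row_mx rowK row0.
  have -> : row_mx (vbasis W)`_i 0 =
      row_mx ((vbasis W)`_i + x0) 1%:M - row_mx x0 1%:M :> 'rV[R]_(s + 1).
    by rewrite opp_row_mx add_row_mx addrK subrr.
  rewrite addmx_sub ?eqmx_opp //; apply: affine_hull_homogenize; apply/affP.
  by rewrite addrK; apply: vbasis_mem; rewrite mem_nth ?size_tuple.
have UM : (homogenize <= M)%MS.
  apply/row_subP => j; rewrite row_homogenize.
  have /affP/coord_vbasis vj := sub_affine_hull (vertex_in_hull j).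
  apply/submxP; exists (row_mx (\row_i coord (vbasis W) i (v j - x0)) 1%:M).
  rewrite mul_row_col !mul_mx_row mulmx0 !mul1mx add_row_mx add0r; congr row_mx.
  apply/eqP; rewrite -subr_eq; apply/eqP; rewrite {1}vj mulmx_sum_row.
  by apply: eq_bigr => i _; rewrite mxE rowK.
have -> : \rank homogenize = \rank M.
  by apply/eqP; rewrite eqn_leq !mxrankS.
apply/eqP; rewrite -[(\dim W).+1]addn1 -/(row_free M) -kermx_eq0; apply/rowV0P => y /sub_kermxP.
rewrite -(hsubmxK y) mul_row_col !mul_mx_row mulmx0 mulmx1 add_row_mx add0r.
rewrite -[X in _ = X -> _]row_mx0 => /eq_row_mx[y1 y2].
move: y1; rewrite y2 mul0mx addr0 mulmx_sum_row => y1.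
have /freeP fW := basis_free (vbasisP W).
have {}y1 i : lsubmx y 0 i = 0.
  by apply: fW; rewrite -[RHS]y1; apply: eq_bigr => k _; rewrite rowK.
rewrite (_ : lsubmx y = 0) ?row_mx0 //.
by apply/rowP => i; rewrite y1 mxE.
Qed.

Hypothesis hv : forall j i, v j 0 i \is a Num.nat.

Lemma dilate_bounds n a i : dilate n P a ->
  0 <= a 0 i <= n%:R * \sum_j v j 0 i.
Proof.
move=> [x /conv_hull_rangeP[c [c0 c1] ->] <-].
have vi j : 0 <= v j 0 i by apply: natr_ge0.
have cle j : c 0 j <= 1.
  by rewrite -c1 (bigD1 j) //= lerDl sumr_ge0.
rewrite mxE mulr_ge0 ?ler0n //=; last first.
  by rewrite mxE; apply: sumr_ge0 => j _; rewrite mxE mulr_ge0.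
rewrite ler_wpM2l ?ler0n // mxE; apply: ler_sum => j _; rewrite mxE.
by rewrite ler_piMl.
Qed.

Lemma lattice_coord_nat n a i : lattice_points (dilate n P) a -> a 0 i \is a Num.nat.
Proof.
by move=> [aP /(_ i) aZ]; rewrite natrEint aZ; case/andP: (dilate_bounds i aP).
Qed.

Lemma finite_lattice_points n : finite_set (lattice_points (dilate n P)).
Proof.
have /natrP[K KE] : n%:R * \sum_i \sum_j v j 0 i \is a Num.nat.
  by rewrite rpredM ?natr_nat // rpred_sum // => i _; rewrite rpred_sum.
pose f (g : {ffun 'I_s -> 'I_K.+1}) : 'rV[R]_s := \row_i (g i)%:R.
apply: (@sub_finite_set _ _ (range f)); last exact/finite_image/finite_finset.
move=> a aL; have aP := aL.1.
exists [ffun i => inord (Num.truncn (a 0 i))] => //.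
apply/rowP => i; rewrite mxE ffunE.
have /natrP[k ak] := lattice_coord_nat i aL.
rewrite ak natrK inordK // ltnS -(ler_nat R) -ak -KE.
case/andP: (dilate_bounds i aP) => _ /le_trans; apply.
rewrite ler_wpM2l ?ler0n // (bigD1 i) //= lerDl; apply: sumr_ge0 => k' _.
by apply: sumr_ge0 => j _; apply: natr_ge0.
Qed.

Variable w : {scalar 'rV[R]_s}.
Hypothesis hwN : forall i, w (delta_mx 0 i) \is a Num.nat.

Lemma weight_nat (a : 'rV[R]_s) : (forall i, a 0 i \is a Num.nat) -> w a \is a Num.nat.
Proof.
by move=> aN; rewrite weight_coord; apply: rpred_sum => i _; rewrite rpredM.
Qed.

Lemma weight_ge0 x : P x -> 0 <= w x.
Proof.
move=> [k [p [c [pv c0 _ ->]]]]; rewrite linear_sum; apply: sumr_ge0 => i _.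
rewrite linearZ mulr_ge0 //; have [j _ <-] := pv i.
by apply: natr_ge0; apply: weight_nat.
Qed.

End Homogenization.

(** * The lifted polytope and the weighted Ehrhart function *)

Section LiftedPolytope.
Variables (R : realType) (s m : nat) (v : 'I_m -> 'rV[R]_s).
Variable w : {scalar 'rV[R]_s}.
Hypothesis hv : forall j i, v j 0 i \is a Num.nat.
Hypothesis hwN : forall i, w (delta_mx 0 i) \is a Num.nat.

Let P := conv_hull (range v).

Lemma lifted_polytope_sub z : lifted_polytope v w z ->
  P (lsubmx z) /\ 0 <= rsubmx z 0 0 <= w (lsubmx z).
Proof.
move=> [k [p [c [pv c0 c1 ->]]]].
have pP i : range v (lsubmx (p i)) /\ 0 <= rsubmx (p i) 0 0 <= w (lsubmx (p i)).
  have wv j : 0 <= w (v j) by apply: (weight_ge0 hv hwN); apply: vertex_in_hull.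
  by case: (pv i) => -[j _ <-]; rewrite row_mxKl row_mxKr mxE ?lexx wv; split=> //; exists j.
rewrite !linear_sum /= summxE; split.
  exists k, (fun i => lsubmx (p i)), c; split=> // [i|]; first by case: (pP i).
  by apply: eq_bigr => i _; rewrite linearZ.
apply/andP; split; [apply: sumr_ge0|apply: ler_sum] => i _.
  by rewrite linearZ mxE mulr_ge0 //; case: (pP i) => _ /andP[].
by rewrite !linearZ mxE /= ler_wpM2l //; case: (pP i) => _ /andP[].
Qed.

(** The point at fraction [t] of the vertical segment over a convex combination
    of vertices gives the weights [(1 - t) c_i] to the bottom and [t c_i] to the
    top copies of the vertices. *)
Lemma lifted_polytope_segment x t : P x -> 0 <= t <= 1 ->
  lifted_polytope v w (row_mx x (const_mx (t * w x) : 'rV_1)).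
Proof.
move=> [k [p [c [pv c0 c1 ->]]]] /andP[t0 t1].
pose q (i : 'I_(k + k)) := match fintype.split i with
  | inl i => row_mx (p i) (0 : 'rV_1)
  | inr i => row_mx (p i) (const_mx (w (p i)) : 'rV_1) end.
pose e (i : 'I_(k + k)) := match fintype.split i with
  | inl i => (1 - t) * c i | inr i => t * c i end.
have ql i : q (lshift k i) = row_mx (p i) 0 by rewrite /q (unsplitK (inl i)).
have qr i : q (rshift k i) = row_mx (p i) (const_mx (w (p i))).
  by rewrite /q (unsplitK (inr i)).
have el i : e (lshift k i) = (1 - t) * c i by rewrite /e (unsplitK (inl i)).
have er i : e (rshift k i) = t * c i by rewrite /e (unsplitK (inr i)).
exists (k + k)%N, q, e; split.
- move=> i; rewrite /q; case: (fintype.split i) => j; have [l _ <-] := pv j.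
    by left; exists l.
  by right; exists l.
- by move=> i; rewrite /e; case: (fintype.split i) => j; rewrite mulr_ge0 // subr_ge0.
- rewrite big_split_ord (eq_bigr _ (fun i _ => el i)) (eq_bigr _ (fun i _ => er i)).
  by rewrite /= -!mulr_sumr c1; ring.
- rewrite big_split_ord.
  under eq_bigr => i _ do rewrite /= el ql scale_row_mx scaler0.
  under [X in _ = _ + X]eq_bigr => i _ do rewrite /= er qr scale_row_mx.
  have sum_row (f : 'I_k -> 'rV[R]_s) (g : 'I_k -> 'rV[R]_1) :
      \sum_i row_mx (f i) (g i) = row_mx (\sum_i f i) (\sum_i g i).
    by elim/big_rec3: _ => [|i y1 y2 y3 _ ->]; rewrite ?row_mx0 ?add_row_mx.
  rewrite !sum_row add_row_mx -big_split big1_eq add0r; congr row_mx.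
    by apply: eq_bigr => i _; rewrite /= -scalerDl; congr (_ *: _); ring.
  rewrite linear_sum mulr_sumr; apply/rowP => j; rewrite summxE mxE.
  by apply: eq_bigr => i _; rewrite linearZ !mxE /=; ring.
Qed.

Lemma dilate_lifted n z : dilate n (lifted_polytope v w) z <->
  dilate n P (lsubmx z) /\ 0 <= rsubmx z 0 0 <= w (lsubmx z).
Proof.
split=> [[y /lifted_polytope_sub[yP /andP[y0 yw]] <-]|].
  split; first by exists (lsubmx y) => //; rewrite linearZ.
  by rewrite !linearZ mxE /= mulr_ge0 ?ler0n // ler_wpM2l ?ler0n.
move=> [[x xP xz] /andP[z0 zw]]; pose t := rsubmx z 0 0 / w (lsubmx z).
(* If the segment is a point, division by zero makes [t] zero. *)
have t01 : 0 <= t <= 1.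
  rewrite divr_ge0 //; last exact: le_trans zw.
  have [w0|w0] := leP (w (lsubmx z)) 0.
    by rewrite /t (_ : rsubmx z 0 0 = 0) ?mul0r ?ler01 //; lra.
  by rewrite ler_pdivrMr // mul1r.
exists (row_mx x (const_mx (t * w x))); first exact: lifted_polytope_segment.
rewrite scale_row_mx xz -[RHS](hsubmxK z); congr row_mx.
apply/rowP => j; rewrite !ord1 !mxE mulrCA -[n%:R * w x]linearZ xz.
have [w0|w0] := eqVneq (w (lsubmx z)) 0; last by rewrite /t divfK // mxE.
rewrite w0 mulr0; move: z0 zw; rewrite w0 !mxE => z0 zw.
by apply/eqP; rewrite eq_le z0 zw.
Qed.

Lemma ehrhart_sum N (Q : set 'rV[R]_N) n : finite_set (lattice_points (dilate n Q)) ->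
  (ehrhart Q n)%:R = \sum_(a \in lattice_points (dilate n Q)) (1 : R).
Proof.
by move=> fin; rewrite /ehrhart fsbig_finite // card_fset_sum1 natr_sum big_seq_fsetE.
Qed.

(** Above a lattice point [a] of the dilate, the lattice points of the dilated
    lifted polytope have heights [0], ..., [w a]. *)
Lemma ehrhart_lifted n : weighted_ehrhart P w n =
  (ehrhart (lifted_polytope v w) n)%:R - (ehrhart P n)%:R.
Proof.
set A := lattice_points (dilate n P).
set Z := lattice_points (dilate n (lifted_polytope v w)).
have finA : finite_set A by apply: finite_lattice_points.
have wA a : A a -> w a = (Num.truncn (w a))%:R.
  move=> aA; have /natrP[k ->] : w a \is a Num.nat.
    by apply: weight_nat => // i; apply: lattice_coord_nat aA.
  by rewrite natrK.
(* A common strict bound for all heights, so that the fibres fit in a product. *)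
pose K := (\sum_(a <- fset_set A) Num.truncn (w a)).+1.
have wK a : A a -> (Num.truncn (w a) < K)%N.
  move=> aA; rewrite ltnS (big_rem a) /= ?leq_addr //.
  by rewrite in_fset_set ?mem_set.
pose up (x : 'rV[R]_s * nat) : 'rV[R]_(s + 1) := row_mx x.1 (const_mx x.2%:R).
pose D : set ('rV[R]_s * nat) := (A `*` `I_K) `&` [set x | (x.2 <= Num.truncn (w x.1))%N].
have bij : set_bij D Z up.
  split.
  - move=> [a k] [[aA kK] /= ka]; split.
      apply/dilate_lifted; rewrite row_mxKl row_mxKr mxE ler0n /=; split; first by case: aA.
      by rewrite (wA _ aA) ler_nat.
    move=> i; rewrite /up /=; case: (split_ordP i) => j ->.
      by rewrite row_mxEl; case: aA.
    by rewrite row_mxEr mxE intr_nat // natr_nat.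
  - move=> [a k] [b l] _ _ /eq_row_mx[/= -> /rowP/(_ 0)].
    by rewrite !mxE => /eqP; rewrite eqr_nat => /eqP ->.
  - move=> z [/dilate_lifted[zP /andP[z0 zw]] zZ].
    have aA : A (lsubmx z) by split=> // i; rewrite mxE.
    have /natrP[k zk] : rsubmx z 0 0 \is a Num.nat by rewrite natrEint z0 andbT mxE.
    have kw : (k <= Num.truncn (w (lsubmx z)))%N by rewrite -(ler_nat R) -wA // -zk.
    exists (lsubmx z, k).
      by split=> //; split=> //=; apply: leq_ltn_trans kw (wK _ aA).
    rewrite /up /= -[RHS](hsubmxK z); congr row_mx.
    by apply/rowP => j; rewrite mxE -zk ord1.
have finZ : finite_set Z.
  have [_ _ surj] := bij; apply: sub_finite_set surj _.
  by apply/finite_image/finite_setIl/finite_setX => //; apply: finite_II.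
rewrite !ehrhart_sum // -/A -/Z (reindex_fsbig _ _ _ _ bij) fsbig_mkcondr.
pose F a k : R := if ((a, k) : 'rV[R]_s * nat) \in
  [set x | (x.2 <= Num.truncn (w x.1))%N] then 1 else 0.
transitivity (\sum_(a \in A) \sum_(k \in `I_K) F a k - \sum_(a \in A) (1 : R)).
  rewrite /weighted_ehrhart -/P -/A !fsbig_finite // -sumrB !big_seq.
  apply: eq_bigr => a; rewrite in_fset_set // inE => aA.
  rewrite -fsbig_ord (wA _ aA) (eq_bigr (fun k : 'I_K => (k < (Num.truncn (w a)).+1)%:R)).
    rewrite (_ : \sum_(k < K) _ = (Num.truncn (w a)).+1%:R); first by rewrite -natr1 addrK.
    transitivity (\sum_(k < K | (k < (Num.truncn (w a)).+1)%N) (1 : R)).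
      by rewrite [RHS]big_mkcond; apply: eq_bigr => k _; case: leqP.
    by rewrite -(big_ord_widen K (fun=> 1)) ?wK // sumr_const card_ord.
  move=> k _; rewrite /F; case: ifP => [/set_mem/= ka|/negP ka].
    by rewrite ltnS ka.
  by case: leqP => // ka'; case: ka; apply/mem_set.
by congr (_ - _); rewrite pair_fsbig.
Qed.

(** Some coordinate with positive coefficient [eta i] is nonzero at a point of
    [P], hence at a vertex; all other terms of the weight of this vertex are
    nonnegative. *)
Lemma vertex_gt0 (eta : 'I_s -> R) :
  (exists x, w x != 0) -> (forall x, w x = \sum_(i < s) eta i * x 0 i) ->
  (forall i, 0 < eta i -> exists2 x, P x & x 0 i != 0) ->
  exists j, 0 < w (v j).
Proof.
move=> [x wx] wE etaP.
have etaE i : eta i = w (delta_mx 0 i).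
  rewrite wE (bigD1 i) //= !mxE !eqxx mulr1 big1 ?addr0 // => k /negPf ki.
  by rewrite mxE ki mulr0.
have eta_ge0 i : 0 <= eta i by rewrite etaE natr_ge0.
have [i eta_i] : exists i, 0 < eta i.
  apply/not_existsP => eta0; case/eqP: wx; rewrite wE big1 // => i _.
  have /negP := eta0 i; rewrite -leNgt => e.
  by rewrite (_ : eta i = 0) ?mul0r //; apply/eqP; rewrite eq_le e eta_ge0.
have [y /conv_hull_rangeP[c [c0 _] ->] yi] := etaP i eta_i.
apply/not_existsP => w0; case/eqP: yi; rewrite mxE big1 // => j _; rewrite mxE.
have vj k : 0 <= v j 0 k by apply: natr_ge0.
have /negP := w0 j; rewrite -leNgt wE => wj.
have /eqP : \sum_k eta k * v j 0 k == 0.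
  by rewrite eq_le wj sumr_ge0 // => k _; rewrite mulr_ge0.
move/eqP; rewrite psumr_eq0 => [/allP/(_ i (mem_index_enum _))|k _]; last exact: mulr_ge0.
by rewrite /= mulf_eq0 gt_eqF //= => /eqP ->; rewrite mulr0.
Qed.

Lemma weighted_ehrhart1_gt0 j : 0 < w (v j) -> 0 < weighted_ehrhart P w 1.
Proof.
move=> wj; rewrite /weighted_ehrhart fsbig_finite; last exact: finite_lattice_points.
have vL : lattice_points (dilate 1 P) (v j).
  split=> [|i]; last by rewrite intr_nat.
  by exists (v j); rewrite ?scale1r //; apply: vertex_in_hull.
have fin := @finite_lattice_points _ _ _ _ hv 1.
rewrite (bigD1_seq (v j)) ?fset_uniq ?in_fset_set ?mem_set //=.
rewrite ltr_pwDl // big_seq_cond; apply: sumr_ge0 => a /andP[].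
rewrite in_fset_set // inE => aL _; apply/natr_ge0/weight_nat => // i.
exact: lattice_coord_nat aL.
Qed.

(** The preceding theory for the cone over [P] at height one, with the weight
    that ignores the height; its integer points of height [n] are those of
    [n P]. *)
Theorem weighted_ehrhart_series d : has_dim P d -> exists h : nat -> R,
  [/\ forall n, h n \is a Num.nat, forall n, (d.+1 < n)%N -> h n = 0
    & iter d.+2 (@bdiff R) (weighted_ehrhart P w) = h].
Proof.
move=> Pd; have rk := rank_homogenize Pd.
have m_gt0 : (0 < m)%N.
  rewrite lt0n; apply/eqP => m0; have := rank_leq_row (homogenize v).
  by rewrite rk m0.
pose L : set 'rV[R]_(s + 1) := [set z | forall i, z 0 i \is a Num.int].
pose deg (z : 'rV[R]_(s + 1)) := rsubmx z 0 0.
have deg_mul c : deg (c *m homogenize v) = \sum_j c 0 j.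
  by rewrite /deg mul_homogenize row_mxKr mxE eqxx.
pose wl : {scalar 'rV[R]_(s + 1)} := w \o lsubmx.
have bij n : set_bij (lattice_points (dilate n P)) (level (homogenize v) deg L n)
    (fun a => row_mx a (n%:R%:M : 'M_1)).
  split.
  - move=> a [aP aZ]; split; first exact/dilate_in_cone.
      move=> i; case: (split_ordP i) => j ->; first by rewrite row_mxEl.
      by rewrite row_mxEr !mxE rpredMn // intr_nat // natr_nat.
    by rewrite /deg row_mxKr mxE eqxx.
  - by move=> a b _ _ /eq_row_mx[].
  - move=> z [zU zL zn]; have ez : z = row_mx (lsubmx z) (n%:R%:M : 'M_1).
      rewrite -{1}(hsubmxK z) -zn; congr row_mx.
      by apply/matrixP => i j; rewrite !ord1 [RHS]mxE eqxx.
    exists (lsubmx z) => //; split; first by apply/dilate_in_cone; rewrite -?ez.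
    by move=> i; rewrite mxE.
have fin n : finite_set (level (homogenize v) deg L n).
  have [_ _ surj] := bij n; apply: sub_finite_set surj _.
  exact/finite_image/finite_lattice_points.
have rowL i j : row j (homogenize v) 0 i \is a Num.int.
  rewrite row_homogenize; case: (split_ordP i) => k ->; first by rewrite row_mxEl intr_nat.
  by rewrite row_mxEr mxE rpredMn ?rpred1.
have w_ray j : wl (row j (homogenize v)) \is a Num.nat.
  by rewrite /= row_homogenize row_mxKl; apply: weight_nat.
have := @cone_series _ _ _ (homogenize v) deg wl L deg_mul _ fin _ w_ray.
case=> [a j|z zL [c c0 zc]|h [h_nat h0 Eh]].
- split=> aL i; last by rewrite mxE rpredD.
  by have := rpredB (aL i) (rowL i j); rewrite mxE addrK.
- apply: (weight_nat hwN) => i; rewrite mxE natrEint zL zc mul_homogenize row_mxEl mxE.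
  by apply: sumr_ge0 => j _; rewrite mulr_ge0 // mxE natr_ge0.
exists h; split=> //; first by move=> n; rewrite -rk; apply: h0.
rewrite -Eh rk; congr (iter _ _ _); apply/funext => n.
rewrite (reindex_fsbig _ _ _ _ (bij n)); apply: eq_fsbigr => a _.
by rewrite /= row_mxKl.
Qed.

End LiftedPolytope.

Theorem corollary5p4 (R : realType) (s m : nat) (v : 'I_m -> 'rV[R]_s)
    (w : {scalar 'rV[R]_s})
    (hv : forall j i, v j 0 i \is a Num.nat)
    (hw0 : exists x, w x != 0)
    (hwN : forall i, w (delta_mx 0 i) \is a Num.nat) :
  let P := conv_hull (range v) in
  (forall n : nat,
     weighted_ehrhart P w n
     = (ehrhart (lifted_polytope v w) n)%:R - (ehrhart P n)%:R)
  /\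
  (forall (eta : 'I_s -> R) (d : nat),
     (forall x, w x = \sum_(i < s) eta i * x 0 i) ->
     (forall i, 0 < eta i -> exists2 x, P x & x 0 i != 0) ->
     has_dim P d ->
     (exists p : {poly R},
        size p = d.+2 /\ forall n : nat, weighted_ehrhart P w n = p.[n%:R])
     /\
     (exists h : {poly R},
        [/\ (size h <= d.+2)%N,
            h \is a polyOver Num.nat
          & fps_eq_frac (weighted_ehrhart P w) h ((1 - 'X) ^+ d.+2)])).
Proof.
move=> P; split=> [n|eta d wE wP Pd]; first exact: ehrhart_lifted.
have [h [h_nat h0 Eh]] := weighted_ehrhart_series hv hwN Pd.
have [p [sp pr pE]] := bdiff_polynomial Eh h0.
split.
  (* If the degree dropped, the nonnegative numerator would vanish. *)
  exists p; split=> //; apply/eqP; rewrite eqn_leq sp /= ltnNge; apply/negP => sp'.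
  have : p`_d.+1 = 0 by rewrite nth_default.
  have h_ge0 k : 0 <= h k by apply: natr_ge0.
  rewrite pr => /eqP; rewrite mulf_eq0 invr_eq0 pnatr_eq0 gtn_eqF ?fact_gt0 // orbF.
  rewrite psumr_eq0 // => /allP hz.
  have {}hz : h = fun=> 0.
    apply/funext => k; have [kd|dk] := ltnP k d.+2; last by rewrite h0.
    by apply/eqP; apply: (hz (Ordinal kd)); rewrite mem_index_enum.
  have E0 : weighted_ehrhart P w = fun=> 0.
    apply: (@iter_bdiff_inj _ d.+2); rewrite Eh hz.
    by elim: d.+2 => //= k <-; apply/funext => -[|n]; rewrite /bdiff /= subr0.
  have [j wj] := vertex_gt0 hv hwN hw0 wE wP.
  by have := weighted_ehrhart1_gt0 hv hwN wj; rewrite -/P E0 ltxx.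
exists (\poly_(i < d.+2) h i); split; first exact: size_poly.
  by apply/polyOverP => i; rewrite coef_poly; case: ifP; rewrite ?rpred0.
split.
  by rewrite -horner_coef0 horner_exp !hornerE ?subr0 expr1n oner_eq0.
rewrite fps_mul_1subX_exp Eh; apply/funext => n; rewrite /fps_of_poly coef_poly.
by case: ltnP => // /h0.
Qed.
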